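(* Let $n\ge3$ be an integer. For every integer $r\ge4$, the characteristic polynomials satisfy $$\Phi_{n,r}=x^{\,n-2}\,\Phi_{n,r-1}-x^{\,2(n-3)}\,\Phi_{n,r-3}.$$
   Context: For integers $n\ge3$ and $r\ge1$, the digraph $\Gamma_{n,r}$ has vertex set $V(\Gamma_{n,r})=\{1,2,\dots,rn-2r+2\}$ and directed edge set $E(\Gamma_{n,r})$ defined by $E(\Gamma_{n,1})=\{(j,j+1):1\le j\le n-1\}\cup\{(n,1)\}$; $E(\Gamma_{n,2})=E(\Gamma_{n,1})\cup\{(1,n+1)\}\cup\{(j,j+1):n+1\le j\le 2n-3\}\cup\{(2n-2,n)\}$; and for $r\ge3$, $E(\Gamma_{n,r})=E(\Gamma_{n,2})\cup\bigcup_{i=1}^{r-2}F_i$, where $F_i=\{(in-2i+2,\,in+n-2i+1)\}\cup\{(j,j+1):in+n-2i+1\le j\le in+2n-2i-3\}\cup\{(in+2n-2i-2,\,in+n-2i)\}$. (For $n=3$ the middle path parts are empty.) The adjacency matrix $A_{n,r}$ is the $(0,1)$-matrix indexed by $V(\Gamma_{n,r})$ whose $(u,v)$-entry is $1$ if and only if $(u,v)\in E(\Gamma_{n,r})$, and $\Phi_{n,r}=\Phi_{n,r}(x)=\det(xI-A_{n,r})\in\mathbb Z[x]$. *)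

(* Defs.v *)
From HB Require Import structures.
From mathcomp Require Import all_boot all_order all_algebra.
Set Implicit Arguments.
Unset Strict Implicit.
Unset Printing Implicit Defensive.
Import GRing.Theory.
Local Open Scope ring_scope.

(* Edge sets are boolean relations on natural-number labels u, v, numbered from
   1.  The subtractions are on nat; none of them truncates when 3 <= n. *)

Definition edge1 (n u v : nat) : bool :=
  ((1 <= u <= n - 1) && (v == u + 1) || (u == n) && (v == 1))%N.

Definition edge2 (n u v : nat) : bool :=
  [|| edge1 n u v,
      (u == 1) && (v == n + 1),
      (n + 1 <= u <= 2 * n - 3) && (v == u + 1)
    | (u == 2 * n - 2) && (v == n)]%N.

Definition edgeF (n i u v : nat) : bool :=
  [|| (u == i * n - 2 * i + 2) && (v == i * n + n - 2 * i + 1),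
      (i * n + n - 2 * i + 1 <= u <= i * n + 2 * n - 2 * i - 3)
        && (v == u + 1)
    | (u == i * n + 2 * n - 2 * i - 2) && (v == i * n + n - 2 * i)]%N.

(* The value at r = 0 is irrelevant. *)
Definition edge (n r u v : nat) : bool :=
  match r with
  | 0 => false
  | 1 => edge1 n u v
  | 2 => edge2 n u v
  | _ => edge2 n u v || has (fun i => edgeF n i u v) (iota 1 (r - 2))
  end.

Definition order_Gamma (n r : nat) : nat := (r * n - 2 * r + 2)%N.

(* The ordinal u stands for the vertex u + 1 of {1, ..., rn - 2r + 2}. *)
Definition Gamma (n r : nat) : rel 'I_(order_Gamma n r) :=
  fun u v => edge n r u.+1 v.+1.

Definition adj (n r : nat) : 'M[int]_(order_Gamma n r) :=
  \matrix_(u, v) (Gamma u v)%:R.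

Definition Phi (n r : nat) : {poly int} := char_poly (adj n r).

(* Main.v *)
Require Import Defs.
From mathcomp Require Import all_boot all_order all_algebra all_fingroup.
From mathcomp Require Import zify ring.
Set Implicit Arguments.
Unset Strict Implicit.
Unset Printing Implicit Defensive.
Import GRing.Theory.
Local Open Scope ring_scope.

(** The digraph is a strip of [r] directed [n]-cycles, consecutive ones sharing
    an edge, and all cycles fit one pattern.  Let [n = p + 3], let
    [L_(-1), L_0, L_1, ..., L_r] be the vertices 2, 1, n, 2n - 2, ..., and call
    them the spine.  The edges are the spine steps [L_k -> L_(k-1)] and, for each
    [k >= 1], a path [L_(k-2) -> ... -> L_k] through [p] internal vertices, the
    block of [k].  Below, spine vertices are numbered from 0, so that [L_k] has
    index [k + 1], and vertices of the digraph are numbered from 0 as well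
    ([edge_internal], [edge_spine]).

    The internal vertices are eliminated by column operations on [xI - A].  An
    internal vertex has only one successor, so the vector with entries
    [1, x, ..., x^p] along the block of [k], where [x^p] stands at [L_k], is mapped
    by [xI - A] to a vector that vanishes on all internal vertices
    ([weight_step]).  Replacing the column of [L_k] by the combination with these
    weights multiplies the determinant by [x^p] for each [k >= 1], and makes the
    matrix block triangular, with the triangular internal block of
    determinant [x^(rp)].  These two factors cancel ([det_collapse]), so that
    [Phi] is the determinant of a matrix [band] of size [r + 2] on the spine
    ([Phi_band]).

    In [band] only the diagonal, the subdiagonal and the second superdiagonal are
    nonzero.  Expanding the determinant of such a matrix along its last rows gives
    a recurrence with steps 1 and 3 ([det_band_rec]): the first term comes from
    the last diagonal entry [x^(p+1)], the other from the 3-cycle of the last three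
    indices, with entries [-1], [-x^p], [-x^p].  This is the claim. *)

(** * Determinants *)

Lemma det_mxsub_inj (R : comPzRingType) N K (A : 'M[R]_N) (h : 'I_K -> 'I_N) :
  K = N -> injective h -> \det (mxsub h h A) = \det A.
Proof.
move=> e; subst K => hI.
have -> : mxsub h h A = row_perm (perm hI) (col_perm (perm hI) A).
  by apply/matrixP=> i j; rewrite !mxE !permE.
rewrite row_permE col_permE !det_mulmx !det_perm odd_permV.
by rewrite mulrCA -signr_addb addbb mulr1.
Qed.

Definition leading (R : Type) (f : nat -> nat -> R) k : 'M[R]_k :=
  \matrix_(i, j) f i j.

(** A permutation that uses the last index either fixes it or runs through the
    3-cycle on the last three indices, since the only way up is by 2 and the only
    way down is by 1. *)
Lemma det_band_rec (R : comPzRingType) (f : nat -> nat -> R) k :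
  (forall i j, i != j -> i != j.+1 -> j != i.+2 -> f i j = 0) ->
  \det (leading f k.+3) =
    f k.+2 k.+2 * \det (leading f k.+2)
    + f k k.+2 * f k.+1 k * f k.+2 k.+1 * \det (leading f k).
Proof.
move=> fb.
rewrite (expand_det_row (leading f k.+3) ord_max).
rewrite big_ord_recr big_ord_recr /= big1 ?add0r; last first.
  by move=> i _; rewrite mxE fb ?mul0r //=; have := ltn_ord i; lia.
rewrite !mxE /= addrC; congr (_ + _).
  congr (_ * _); rewrite /cofactor /= -signr_odd addnn odd_double mul1r.
  congr (\det _); apply/matrixP=> i j; rewrite !mxE /= /bump.
  by congr f; have := ltn_ord i; have := ltn_ord j; lia.
set c := widen_ord _ _.
pose B : 'M[R]_k.+2 := \matrix_(i, j) f i (bump k.+1 j).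
have -> : cofactor (leading f k.+3) ord_max c = - \det B.
  rewrite /cofactor -signr_odd (_ : odd _ = true) ?expr1 ?mulN1r; last by rewrite /=; lia.
  congr (- \det _); apply/matrixP=> i j; rewrite !mxE /=.
  by congr f; have := ltn_ord i; rewrite /c /bump /=; lia.
(* Row [k + 1] has no entry in column [k + 2], which leaves row [k]. *)
rewrite (expand_det_col B ord_max).
rewrite big_ord_recr big_ord_recr /= big1 ?add0r; last first.
  by move=> i _; rewrite mxE /= fb ?mul0r //=; have := ltn_ord i; rewrite /bump; lia.
rewrite !mxE /= [f k.+1 (bump _ _)]fb ?mul0r ?addr0; try by rewrite /bump; lia.
set d := widen_ord _ _.
have -> : bump k.+1 k.+1 = k.+2 by rewrite /bump; lia.
pose C : 'M[R]_k.+1 := \matrix_(i, j) f (bump k i) j.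
have -> : cofactor B d ord_max = - \det C.
  rewrite /cofactor -signr_odd (_ : odd _ = true) ?expr1 ?mulN1r; last by rewrite /=; lia.
  congr (- \det _); apply/matrixP=> i j; rewrite !mxE /=.
  by congr f; have := ltn_ord j; rewrite /d /bump /=; lia.
rewrite (expand_det_row C ord_max).
rewrite big_ord_recr /= big1 ?add0r; last first.
  by move=> i _; rewrite mxE /= fb ?mul0r //=; have := ltn_ord i; rewrite /bump; lia.
have -> : cofactor C ord_max ord_max = \det (leading f k).
  rewrite /cofactor /= -signr_odd addnn odd_double mul1r.
  congr (\det _); apply/matrixP=> i j; rewrite !mxE /=.
  by congr f; have := ltn_ord i; have := ltn_ord j; rewrite /bump; lia.
rewrite mxE /= (_ : bump k k = k.+1); last by rewrite /bump; lia.
ring.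
Qed.

(** Elimination of the indices [g] in favour of the indices [f].  The columns of
    [F] replace the columns [f] of [A]: in the order [f], [g], the product of [A]
    with [block_mx (rowsub f F) 0 (rowsub g F) 1] is block triangular. *)
Lemma det_collapse (R : comPzRingType) N a b (A : 'M[R]_N) (F : 'M[R]_(N, a))
    (f : 'I_a -> 'I_N) (g : 'I_b -> 'I_N) :
  (a + b)%N = N -> injective f -> injective g -> (forall i j, f i != g j) ->
  rowsub g (A *m F) = 0 ->
  \det A * \det (rowsub f F) = \det (rowsub f (A *m F)) * \det (mxsub g g A).
Proof.
move=> eN; subst N => fI gI fg AF0.
pose h (k : 'I_(a + b)) := match split k with inl i => f i | inr j => g j end.
have hI : injective h.
  move=> k1 k2; rewrite /h.
  case: (split_ordP k1) => i1 ->; case: (split_ordP k2) => i2 ->.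
  - by move/fI->.
  - by move/eqP; rewrite (negPf (fg _ _)).
  - by move/esym/eqP; rewrite (negPf (fg _ _)).
  - by move/gI->.
have hl i : h (lshift b i) = f i.
  by rewrite /h -[lshift _ _]/(unsplit (inl i)) unsplitK.
have hr j : h (rshift a j) = g j.
  by rewrite /h -[rshift _ _]/(unsplit (inr j)) unsplitK.
have -> : \det (rowsub f F) = \det (block_mx (rowsub f F) 0 (rowsub g F) 1%:M).
  by rewrite det_lblock det1 mulr1.
rewrite -(det_ublock _ (mxsub f g A)) -(det_mxsub_inj A erefl hI) -det_mulmx.
congr (\det _); apply/matrixP => k i; rewrite mxE.
case: (split_ordP i) => {}i ->.
  transitivity ((A *m F) (h k) i).
    rewrite mxE [RHS](reindex_inj hI); apply: eq_bigr => l _.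
    rewrite mxE; congr (_ * _); case: (split_ordP l) => l' ->.
      by rewrite block_mxEul mxE hl.
    by rewrite block_mxEdl mxE hr.
  case: (split_ordP k) => {}k ->; first by rewrite block_mxEul [RHS]mxE hl.
  by rewrite block_mxEdl hr -AF0 [RHS]mxE.
rewrite (bigD1 (rshift a i)) //= block_mxEdr [X in _ * X + _]mxE eqxx mulr1.
rewrite [X in X + _]mxE hr.
rewrite big1 ?addr0; last first.
  move=> l; case: (split_ordP l) => l' ->.
    by rewrite block_mxEur [X in _ * X]mxE mulr0.
  rewrite block_mxEdr [X in _ * X]mxE eq_rshift => /negPf->.
  by rewrite mulr0.
case: (split_ordP k) => {}k ->; first by rewrite block_mxEur [RHS]mxE hl.
by rewrite block_mxEdr [RHS]mxE hr.
Qed.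

Lemma sum_delta (R : pzRingType) N (c : nat -> R) a :
  ((N <= a)%N -> c a = 0) -> \sum_(v < N) (v == a :> nat)%:R * c v = c a.
Proof.
move=> ca; case: (ltnP a N) => [aN|aN]; last rewrite (ca aN).
- rewrite (bigD1 (Ordinal aN)) //= eqxx mul1r big1 ?addr0 // => v.
  by rewrite -val_eqE /= => /negPf->; rewrite mul0r.
- apply: big1 => v _; rewrite (_ : (_ == _) = false) ?mul0r //.
by have := ltn_ord v; lia.
Qed.

(** * The edges of the digraph *)

Section Edges.

Local Open Scope nat_scope.

(** [spine p i] is the vertex [L_(i-1)]; for [i >= 2] it closes the block number
    [i - 2], which occupies the [p + 1] vertices from [(i - 2) * (p + 1) + 2] on. *)
Definition spine (p i : nat) : nat :=
  match i with 0 => 1 | 1 => 0 | j.+2 => j * p.+1 + p.+2 end.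

Lemma block_inj m q1 q2 s1 s2 : s1 < m -> s2 < m ->
  q1 * m + s1 = q2 * m + s2 -> q1 = q2 /\ s1 = s2.
Proof.
move=> h1 h2 e; have m0 : 0 < m by lia.
have := congr1 (fun x => x %/ m) e.
rewrite !divnMDl // !divn_small // !addn0 => eq.
by split=> //; move: e; rewrite eq => /addnI.
Qed.

Lemma edgeP n r u v : 0 < r -> edge n r u v <->
  [\/ edge1 n u v, (2 <= r) && edge2 n u v
    | exists2 i, 1 <= i <= r - 2 & edgeF n i u v].
Proof.
case: r => [//|[|[|r]]] _.
- split=> [|[]//]; first by constructor 1.
  by case=> i; lia.
- split=> [|[]//]; first by constructor 2.
    by move=> h; apply/orP; left.
  by case=> i; lia.
rewrite /edge.
split.
  case/orP=> [h|/hasP[i]]; first by constructor 2.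
  by rewrite mem_iota => hi hF; constructor 3; exists i => //; lia.
case=> [h|/andP[_ h]|[i hi hF]].
- by apply/orP; left; rewrite /edge2 h.
- by apply/orP; left.
by apply/orP; right; apply/hasP; exists i => //; rewrite mem_iota; lia.
Qed.

(** The vertex with [s < p] at position [s] of block [q] is internal: its path is the
    only way on. *)
Lemma edge_internal p r q s v : q < r -> s < p ->
  edge p.+3 r (q * p.+1 + s + 2).+1 v.+1 = (v == q * p.+1 + s + 3).
Proof.
move=> qr sp; apply/idP/idP.
  move/edgeP => /(_ (leq_ltn_trans (leq0n q) qr)).
  have N : forall i, i * p.+1 <> q * p.+1 + s.+1.
    by move=> i; rewrite -[LHS]addn0 => /block_inj [] //; lia.
  have [[N0 N1] N2] := (N 0, N 1, N 2).
  case; rewrite /edge2 /edge1; [lia|lia|].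
  case=> i hi; have [Ni Nii] := (N i, N i.+2).
  by rewrite /edgeF; lia.
move/eqP->; apply/edgeP; first lia.
case: q qr => [|[|q]] qr.
- by constructor 1; rewrite /edge1; lia.
- by constructor 2; rewrite /edge2 /edge1; lia.
by constructor 3; exists q.+1; [lia|rewrite /edgeF; lia].
Qed.

(** When [i] is [r] or [r + 1] the vertex [i * (p + 1) + 2], which would open
    the next block, falls outside the digraph; the bound on [v] excludes it. *)
Lemma edge_spine p r i v : 0 < r -> i < r + 2 -> v < r * p.+1 + 2 ->
  edge p.+3 r (spine p i).+1 v.+1 =
  (v == i * p.+1 + 2) || (0 < i) && (v == spine p i.-1).
Proof.
move=> r0 ir vN; apply/idP/idP.
  move/edgeP => /(_ r0).
  case: i ir => [|[|i]] ir /=; rewrite /edge2 /edge1.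
  - case; [lia|lia|case=> j hj; rewrite /edgeF].
    have : p.+1 <= j * p.+1 by rewrite leq_pmull //; lia.
    lia.
  - case; [lia|lia|case=> j hj; rewrite /edgeF].
    have : p.+1 <= j * p.+1 by rewrite leq_pmull //; lia.
    lia.
  have P k s : s < p.+1 -> i * p.+1 + p = k * p.+1 + s -> i = k /\ p = s.
    by move=> ? /block_inj; apply.
  case.
  - case: i P ir => [|i] P ir /=; lia.
  - case: i P ir => [|[|i]] P ir /=; lia.
  case=> j hj; rewrite /edgeF => /or3P [].
  - move=> /andP[/eqP e1 /eqP e2].
    have [] : i = j.-1 /\ p = p.
      by apply: P => //; case: j hj e1 {e2} => [|j]; lia.
    by case: j hj e1 e2 => [|j] *; subst; lia.
  - move=> /andP[h1 /eqP e2].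
    have [//||] := P j.+1 (i * p.+1 + p - j.+1 * p.+1); lia.
  move=> /andP[/eqP e1 /eqP e2].
  have [||ei _] := P j.+1 p; [lia|lia|].
  by subst i => /=; lia.
move=> h; apply/edgeP => //.
case/orP: h => [/eqP h|/andP[i0 /eqP h]]; subst v.
  have {}ir : i < r.
    rewrite ltnNge; apply/negP => ri.
    by have := leq_mul ri (leqnn p.+1); lia.
  case: i ir vN => [|[|i]] ir vN /=.
  - by constructor 1; rewrite /edge1; lia.
  - by constructor 2; rewrite /edge2 /edge1; lia.
  by constructor 3; exists i.+1; [lia|rewrite /edgeF; lia].
case: i ir i0 vN => [|[|[|[|i]]]] //= ir i0 vN.
- by constructor 1; rewrite /edge1; lia.
- by constructor 1; rewrite /edge1; lia.
- by constructor 2; rewrite /edge2 /edge1; lia.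
by constructor 3; exists i.+1; [lia|rewrite /edgeF; lia].
Qed.

End Edges.

(** * Spine and internal vertices *)

Lemma order_GammaE p r : order_Gamma p.+3 r = (r * p.+1 + 2)%N.
Proof. by rewrite /order_Gamma; lia. Qed.

(** The [t]-th internal vertex in increasing order: before it come the two vertices
    [L_0], [L_(-1)] and the closing spine vertices of the [t %/ p] earlier blocks. *)
Definition internal (p t : nat) : nat := (t + t %/ p + 2)%N.

Lemma spine_lt p r i : (0 < r)%N -> (i < r + 2)%N ->
  (spine p i < order_Gamma p.+3 r)%N.
Proof.
rewrite order_GammaE; case: i => [|[|j]] r0 ir /=; try lia.
have jr : (j.+1 <= r)%N by lia.
by have := leq_mul jr (leqnn p.+1); lia.
Qed.

Lemma spine_inj p : injective (spine p).
Proof.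
case=> [|[|i]] [|[|j]] //=; try lia.
by move/addIn/eqP; rewrite eqn_pmul2r // => /eqP->.
Qed.

Lemma internalP p r t : (t < r * p)%N -> exists q s,
  [/\ (q < r)%N, (s < p)%N, t = (q * p + s)%N
   & internal p t = (q * p.+1 + s + 2)%N].
Proof.
move=> tr; have p0 : (0 < p)%N by case: (p) tr => //; rewrite muln0.
exists (t %/ p)%N, (t %% p)%N; split.
- by rewrite ltn_divLR.
- by rewrite ltn_mod.
- exact: divn_eq.
rewrite /internal {1}(divn_eq t p); lia.
Qed.

Lemma internal_lt p r t : (t < r * p)%N ->
  (internal p t < order_Gamma p.+3 r)%N.
Proof.
case/internalP => q [s [qr sp _ ->]]; rewrite order_GammaE.
by have := leq_mul qr (leqnn p.+1); lia.
Qed.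

Lemma internal_mono p t t' : (t < t')%N -> (internal p t < internal p t')%N.
Proof.
move=> tt'; have := leq_div2r p (ltnW tt'); rewrite /internal; lia.
Qed.

Lemma internal_inj p : injective (internal p).
Proof.
move=> t t' e; case: (ltngtP t t') => // /(internal_mono p); rewrite e ltnn //.
Qed.

Lemma spine_neq_internal p r i t : (t < r * p)%N -> spine p i <> internal p t.
Proof.
case/internalP => q [s [qr sp _ ->]].
case: i => [|[|j]] /=; [lia|lia|move=> e].
have [|||_ ps] := @block_inj p.+1 j q p s; lia.
Qed.

(** * Weights along the blocks *)

Definition spine_scale (p i : nat) : {poly int} :=
  if i is _.+2 then 'X^p else 1.

(** The entries, indexed by vertices [v], of the combination of columns that
    replaces the column of [spine p i]. *)
Definition weight (p i v : nat) : {poly int} :=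
  match i with
  | 0 => (v == 1%N)%:R
  | 1 => (v == 0%N)%:R
  | j.+2 => if (j * p.+1 + 2 <= v < j * p.+1 + p.+3)%N
            then 'X^(v - (j * p.+1 + 2)) else 0
  end.

(** Since an internal vertex has a single successor, it follows that its row of
    [xI - A] annihilates every weight vector. *)
Lemma weight_step p i q s : (s < p)%N ->
  weight p i (q * p.+1 + s + 3) = 'X * weight p i (q * p.+1 + s + 2).
Proof.
case: i => [|[|j]] sp /=.
- by rewrite !gtn_eqF ?mulr0 //; lia.
- by rewrite !gtn_eqF ?mulr0 //; lia.
case: (ltngtP q j) => [qj|qj|<-].
- have := leq_mul qj (leqnn p.+1) => h.
  by rewrite !ifF ?mulr0 //; lia.
- have := leq_mul qj (leqnn p.+1) => h.
  by rewrite !ifF ?mulr0 //; lia.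
rewrite !ifT; try lia.
by rewrite -exprS; congr ('X^_); lia.
Qed.

Lemma weight_first p i k : weight p i (k * p.+1 + 2) = (i == k.+2)%:R.
Proof.
case: i => [|[|j]] /=.
- by rewrite gtn_eqF //; lia.
- by rewrite gtn_eqF //; lia.
rewrite !eqSS; case: (ltngtP j k) => [jk|jk|->].
- have h := leq_mul jk (leqnn p.+1); rewrite ifF //; lia.
- have h := leq_mul jk (leqnn p.+1); rewrite ifF //; lia.
by rewrite ifT ?subnn //; lia.
Qed.

Lemma weight_spine p i k : weight p i (spine p k) = spine_scale p i *+ (i == k).
Proof.
case: i => [|[|j]]; case: k => [|[|k]] //=; rewrite ?eqSS.
- by rewrite gtn_eqF //; lia.
- by rewrite gtn_eqF //; lia.
- by rewrite ifF //; lia.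
- by rewrite ifF //; lia.
case: (ltngtP j k) => [jk|jk|->].
- have h := leq_mul jk (leqnn p.+1); rewrite ifF //; lia.
- have h := leq_mul jk (leqnn p.+1); rewrite ifF //; lia.
rewrite ifT; last lia.
by rewrite mulr1n; congr ('X^_); lia.
Qed.

Lemma weight_out p r i v : (0 < r)%N -> (i < r + 2)%N ->
  (r * p.+1 + 2 <= v)%N -> weight p i v = 0.
Proof.
have ? : (1 * p.+1 <= r * p.+1)%N || (r == 0)%N.
  by case: (r) => // k; rewrite leq_pmul2r.
case: i => [|[|j]] r0 ir rv /=.
- by rewrite gtn_eqF //; lia.
- by rewrite gtn_eqF //; lia.
have jr : (j.+1 <= r)%N by lia.
have h := leq_mul jr (leqnn p.+1); rewrite ifF //; lia.
Qed.

(** * Reduction to the spine *)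

Lemma char_poly_mx_mulE n r a (F : 'M[{poly int}]_(order_Gamma n r, a))
    (u : 'I_(order_Gamma n r)) i :
  (char_poly_mx (adj n r) *m F) u i =
  'X * F u i - \sum_(v < order_Gamma n r) (edge n r u.+1 v.+1)%:R * F v i.
Proof.
rewrite /char_poly_mx mulmxBl mul_scalar_mx !mxE; congr (_ - _).
by apply: eq_bigr => v _; rewrite !mxE /Gamma; case: edge.
Qed.

(** The rows of [xI - A] at the spine vertices, applied to the weight vectors: the
    middle term is the opening edge of block [k], the last one the spine step. *)
Definition band (p k i : nat) : {poly int} :=
  ('X * spine_scale p i) *+ (i == k) - (i == k.+2)%:R - spine_scale p i *+ (i.+1 == k).

(** [det_collapse] for the spine and the internal vertices; both the scaling of the
    columns and the internal block contribute the factor ['X^(r * p)]. *)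
Lemma Phi_band p r : (0 < r)%N -> Phi p.+3 r = \det (leading (band p) (r + 2)).
Proof.
move=> r0.
pose F : 'M[{poly int}]_(order_Gamma p.+3 r, r + 2) := \matrix_(v, i) weight p i v.
pose f (i : 'I_(r + 2)) := Ordinal (spine_lt p r0 (ltn_ord i)).
pose g (t : 'I_(r * p)) := Ordinal (internal_lt (ltn_ord t)).
set A := char_poly_mx (adj p.+3 r).
have fI : injective f by move=> i j [] /spine_inj /val_inj.
have gI : injective g by move=> i j /(congr1 val) /internal_inj /val_inj.
have fg i t : f i != g t.
  by rewrite -val_eqE; apply/eqP; apply: spine_neq_internal (ltn_ord t).
have eN : (r + 2 + r * p)%N = order_Gamma p.+3 r by rewrite order_GammaE; lia.
have wout (i : 'I_(r + 2)) v : (order_Gamma p.+3 r <= v)%N -> weight p i v = 0.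
  by rewrite order_GammaE => h; apply: weight_out (ltn_ord i) h.
have AF0 : rowsub g (A *m F) = 0.
  apply/matrixP => t i; rewrite mxE char_poly_mx_mulE [RHS]mxE.
  have [q [s [qr sp _ et]]] := internalP (ltn_ord t).
  rewrite mxE /= et -weight_step //; apply/eqP; rewrite subr_eq0 eq_sym; apply/eqP.
  rewrite -[RHS](@sum_delta _ (order_Gamma p.+3 r) (weight p i)); last exact: wout.
  by apply: eq_bigr => v _; rewrite edge_internal // mxE.
have AFs : rowsub f (A *m F) = leading (band p) (r + 2).
  apply/matrixP => k i; rewrite mxE char_poly_mx_mulE !mxE /= weight_spine.
  rewrite /band -mulrnAr -addrA -opprD; congr (_ - _).
  (* The two kinds of successors of a spine vertex are distinct, so that the
     disjunction in [edge_spine] is a sum. *)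
  transitivity (\sum_(v < order_Gamma p.+3 r)
      ((v == k * p.+1 + 2 :> nat)%N%:R * weight p i v +
       ((0 < k)%N && (v == spine p k.-1 :> nat))%:R * weight p i v)).
    apply: eq_bigr => v _; rewrite mxE edge_spine //; last by rewrite -order_GammaE.
    rewrite -mulrDl; congr (_ * _).
    have ne : (k * p.+1 + 2)%N <> spine p k.-1.
      by case: (k : nat) => [|[|[|j]]] /=; lia.
    case: eqP => [->|_] /=; last by rewrite add0r.
    by rewrite (introF eqP ne) andbF addr0.
  rewrite big_split /= sum_delta; last exact: wout.
  rewrite weight_first; congr (_ + _).
  case: (k : nat) => [|k'] /=.
    by rewrite big1 // => v _; rewrite mul0r.
  rewrite sum_delta; last exact: wout.
  by rewrite weight_spine eqSS.
have dF : \det (rowsub f F) = 'X^p ^+ r.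
  rewrite det_trig; last first.
    apply/is_trig_mxP => i j ij; rewrite !mxE /= weight_spine.
    by rewrite gtn_eqF // mulr0n.
  under eq_bigr => i _ do rewrite !mxE /= weight_spine eqxx mulr1n.
  (* The two leading indices have scale 1; the other [r] have scale ['X^p]. *)
  rewrite -(big_mkord xpredT (spine_scale p)) addn2 !big_nat_recl //= !mul1r.
  by rewrite big_const_nat subn0 -Monoid.iteropE.
have dA : \det (mxsub g g A) = 'X ^+ (r * p).
  (* Edges between internal vertices go upwards. *)
  rewrite -det_tr det_trig; last first.
    apply/is_trig_mxP => i j ij; rewrite !mxE.
    rewrite -val_eqE /= /Gamma /=.
    have [q [s [qr sp _ et]]] := internalP (ltn_ord j).
    have lt := internal_mono p ij.
    rewrite et edge_internal // -et gtn_eqF //= [_ == _ :> nat]ltn_eqF //; last lia.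
    by rewrite subrr.
  under eq_bigr => i _.
    rewrite !mxE eqxx /Gamma /=.
    have [q [s [qr sp _ et]]] := internalP (ltn_ord i).
    rewrite et edge_internal // (_ : _ == _ = false); last lia.
    rewrite subr0 mulr1n.
    over.
  by rewrite prodr_const card_ord.
have := det_collapse eN fI gI fg AF0.
rewrite AFs dF dA -exprM mulnC => /mulIf; apply.
by rewrite expf_neq0 // polyX_eq0.
Qed.

Lemma band_diag p k : band p k k = 'X * spine_scale p k.
Proof.
have [e1 e2] : (k == k.+2) = false /\ (k.+1 == k) = false by lia.
by rewrite /band eqxx e1 e2 !subr0.
Qed.

Lemma band_up p k : band p k k.+2 = -1.
Proof.
have [e1 e2] : (k.+2 == k) = false /\ (k.+3 == k) = false by lia.
by rewrite /band eqxx e1 e2 sub0r subr0.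
Qed.

Lemma band_down p k : band p k.+1 k = - spine_scale p k.
Proof.
have [e1 e2] : (k == k.+1) = false /\ (k == k.+3) = false by lia.
by rewrite /band eqxx e1 e2 !sub0r oppr0 add0r.
Qed.

(** * The recurrence *)

Theorem lemma4p1 (n : nat) (hn : (3 <= n)%N) (r : nat) (hr : (4 <= r)%N) :
  Phi n r = 'X^(n - 2) * Phi n (r - 1) - 'X^(2 * (n - 3)) * Phi n (r - 3).
Proof.
case: n hn => [|[|[|p]]] // _; case: r hr => [|[|[|[|r]]]] // _.
rewrite !Phi_band; try lia.
rewrite (_ : (r.+4 - 3 + 2)%N = r.+3); last lia.
rewrite (_ : (r.+4 - 1 + 2)%N = r.+3.+2); last lia.
rewrite (_ : (r.+4 + 2)%N = r.+3.+3); last lia.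
rewrite det_band_rec; last first.
  move=> i j; rewrite /band eq_sym => /negPf-> ; rewrite eq_sym => /negPf-> /negPf->.
  by rewrite !mulr0n !subr0.
rewrite band_diag band_up !band_down /=.
have -> : (p.+3 - 2)%N = p.+1 by lia.
have -> : (2 * (p.+3 - 3))%N = (p * 2)%N by lia.
by rewrite exprM exprS; ring.
Qed.
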